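(* Let $K>0$ be a real constant, let $r$ be a real parameter, and consider the difference equation $$X_{n+1} = X_{n} + r X_{n}\left(1-\frac{X_{n-\tau}}{K}\right)$$ for any integer $\tau\ge 0$. Then there are always two fixed points, $X_1 = \underbrace{(0, 0, \ldots, 0)}_{\tau+1}$ and $X_2 = \underbrace{(K, K, \ldots, K)}_{\tau+1}$, and $X_2$ is stable if $0<r<f(\tau)$, for some function $f:\mathbb{N}\to\mathbb{R}$ that is a monotone decreasing function of $\tau$.
   Context: Here $\mathbb{N}=\{0,1,2,\ldots\}$. The difference equation (the discrete logistic equation with time delay $\tau$) is regarded as the discrete dynamical system on $\mathbb{R}^{\tau+1}$ obtained by iterating the map $$F(x_0,x_1,\ldots,x_\tau)=\left(x_1,x_2,\ldots,x_\tau,\; x_\tau+r x_\tau\left(1-\frac{x_0}{K}\right)\right),$$ where $(x_0,\ldots,x_\tau)$ stands for $(X_{n-\tau},\ldots,X_n)$; for $\tau=0$ this is $F(x_0)=x_0+rx_0(1-x_0/K)$. A fixed point is a point $X\in\mathbb{R}^{\tau+1}$ with $F(X)=X$. A fixed point is called stable if all (complex) eigenvalues of the Jacobian matrix of $F$ at that point have modulus strictly less than $1$ (the standard linear stability test). *)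

(* Defs.v *)
From HB Require Import structures.
From mathcomp Require Import all_boot all_order all_algebra.
From mathcomp Require Import all_classical all_reals all_analysis.
From mathcomp Require Import complex.

Set Implicit Arguments.
Unset Strict Implicit.
Unset Printing Implicit Defensive.

Import Order.TTheory GRing.Theory Num.Theory.
Import numFieldNormedType.Exports.

Local Open Scope ring_scope.

(* The state (x_0, ..., x_tau) stands for (X_{n-tau}, ..., X_n): the map shifts
   the window to the left and appends X_{n+1}. For tau = 0, ord0 = ord_max. *)
Definition logistic_map (R : realType) (r K : R) (tau : nat)
    (x : 'rV[R]_tau.+1) : 'rV[R]_tau.+1 :=
  \row_(i < tau.+1)
    if (i < tau)%N then x 0 (inord i.+1)
    else x 0 ord_max + r * x 0 ord_max * (1 - x 0 ord0 / K).

Definition fixed_point (T : Type) (F : T -> T) (X : T) : Prop := F X = X.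

(* [jacobian] acts on row vectors, i.e. it is the transpose of the usual
   Jacobian matrix, and so has the same eigenvalues. Its entries are embedded
   in R[i], where the norm is the complex modulus (itself valued in R[i]). *)
Definition stable_fixed_point (R : realType) (n : nat)
    (F : 'rV[R]_n.+1 -> 'rV[R]_n.+1) (X : 'rV[R]_n.+1) : Prop :=
  fixed_point F X /\
  forall z : R[i],
    eigenvalue (map_mx (real_complex R) (jacobian F X)) z -> `|z| < 1.

(* Main.v *)
Require Import Defs.
From HB Require Import structures.
From mathcomp Require Import all_boot all_order all_algebra.
From mathcomp Require Import all_classical all_reals all_analysis.
From mathcomp Require Import complex.
From mathcomp Require Import ring.

Set Implicit Arguments.
Unset Strict Implicit.
Unset Printing Implicit Defensive.

Import Order.TTheory GRing.Theory Num.Theory.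
Import numFieldNormedType.Exports.

Local Open Scope ring_scope.

(** A fixed point has all coordinates equal, because the map shifts them, and
    the last coordinate then forces the common value a to satisfy
    a (1 - a / K) = 0 when r is nonzero, so a = 0 or a = K.

    For stability, linearizing at (K, ..., K) gives
    h_n+1 = h_n - r h_(n - tau), so every eigenvalue z of the Jacobian satisfies
    z^(tau + 1) = z^tau - r ([is_diff_logistic],
    [eigenvalue_jacobian_logistic]).  The function chosen is
    f(tau) = 1 / (tau + 1).  It lies below the sharp threshold
    2 cos (tau pi / (2 tau + 1)), and has the advantage that an elementary
    estimate suffices ([char_root_norm_lt1]): a root of modulus at least 1
    satisfies |z - 1| <= r, so z^(-tau) is within r tau of 1, and
    z = 1 - r z^(-tau) is within r (r tau) of 1 - r.  As z is at distance at
    least r from 1 - r, this forces 1 <= r tau, whereas r (tau + 1) < 1. *)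

Lemma fixed_point_logistic_const (R : realType) (r K : R) (tau : nat) (a : R) :
  a * (1 - a / K) = 0 ->
  fixed_point (logistic_map r K (tau := tau)) (const_mx a).
Proof.
move=> a0; apply/rowP => i; rewrite !mxE; case: ifP => // _.
by rewrite -mulrA a0 mulr0 addr0.
Qed.

(** The first tau coordinates of F X = X read X_(i+1) = X_i. *)
Lemma fixed_point_logistic_constant (R : realType) (r K : R) (tau : nat)
    (X : 'rV[R]_tau.+1) :
  fixed_point (logistic_map r K (tau := tau)) X -> X = const_mx (X 0 ord0).
Proof.
move=> FX; apply/rowP => i; rewrite mxE; case: i => m; elim: m => [|m IH] mt.
  by congr (X _ _); apply: val_inj.
have mt' := ltnW mt; rewrite -(IH mt') -[in RHS]FX mxE /= ifT; last exact: mt.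
by congr (X _ _); apply: val_inj; rewrite /= inordK.
Qed.

Lemma fixed_point_logistic (R : realType) (r K : R) (tau : nat)
    (X : 'rV[R]_tau.+1) : K != 0 -> r != 0 ->
  fixed_point (logistic_map r K (tau := tau)) X ->
  X = const_mx 0 \/ X = const_mx K.
Proof.
move=> K0 r0 FX; have Xc := fixed_point_logistic_constant FX.
move/rowP/(_ ord_max): FX; rewrite !mxE ltnn {}Xc !mxE.
set a := X 0 ord0; move/eqP.
rewrite -subr_eq0 addrAC subrr add0r !mulf_eq0 (negPf r0) /= subr_eq0.
case/orP => [/eqP ->|/eqP aK]; [by left | right; congr const_mx].
by rewrite -[RHS](mulr1) aK mulrC divfK.
Qed.

(** A row-valued map is the sum of its coordinates times the basis vectors, so
    the rules for sums and scalings give its differential coordinatewise. *)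
Lemma is_diff_row (R : numFieldType) (V : normedModType R) (n : nat)
    (f df : 'I_n.+1 -> V -> R) (x : V) :
  (forall i, is_diff x (f i) (df i)) ->
  is_diff x (fun y => \row_i f i y) (fun y => \row_i df i y).
Proof.
move=> fP.
have rowE (g : 'I_n.+1 -> V -> R) : (fun y => \row_i g i y) =
    \sum_i (fun y => g i y *: (delta_mx 0 i : 'rV[R]_n.+1)).
  apply/funext => y; rewrite fct_sumE [LHS]row_sum_delta.
  by apply: eq_bigr => i _; rewrite mxE.
rewrite !rowE; elim/big_ind2 : _ => [|f1 d1 f2 d2|i _].
- exact: is_diff_cst.
- exact: is_diffD.
- have [fi dfi] := fP i.
  by split; [exact: differentiableZl | rewrite diffZl // dfi].
Qed.

Lemma is_diff_coord (R : numFieldType) (n : nat) (x : 'rV[R]_n.+1) i :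
  is_diff x (fun y : 'rV[R]_n.+1 => y 0 i : R) (fun y => y 0 i).
Proof.
split; first exact: differentiable_coord.
have lin : linear (fun y : 'rV[R]_n.+1 => y 0 i : R).
  by move=> a u v; rewrite !mxE.
pose m := GRing.isLinear.Build _ _ _ _ _ lin.
pose g : {linear 'rV[R]_n.+1 -> R} := HB.pack (fun y : 'rV[R]_n.+1 => y 0 i : R) m.
by apply: (@diff_lin _ _ _ g); exact: coord_continuous.
Qed.

Lemma is_diff_logistic (R : realType) (r K : R) (tau : nat) : K != 0 ->
  is_diff (const_mx K : 'rV[R]_tau.+1) (logistic_map r K (tau := tau))
    (fun h => \row_(i < tau.+1)
       if (i < tau)%N then h 0 (inord i.+1) else h 0 ord_max - r * h 0 ord0).
Proof.
move=> K0.
apply: (@is_diff_row R 'rV[R]_tau.+1 tau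
  (fun i x => if (i < tau)%N then x 0 (inord i.+1)
    else x 0 ord_max + r * x 0 ord_max * (1 - x 0 ord0 / K))
  (fun i h => if (i < tau)%N then h 0 (inord i.+1)
    else h 0 ord_max - r * h 0 ord0)) => i.
case: (i < tau)%N; first exact: is_diff_coord.
have dmax := is_diff_coord (const_mx K : 'rV[R]_tau.+1) ord_max.
have d0 := is_diff_coord (const_mx K : 'rV[R]_tau.+1) ord0.
(* The rules for differentials see only pointwise operations on functions. *)
rewrite (_ : (fun _ => _) = (fun y : 'rV[R]_tau.+1 => y 0 ord_max : R) +
    (r *: (fun y : 'rV[R]_tau.+1 => y 0 ord_max : R)) *
    (cst 1 - K^-1 *: (fun y : 'rV[R]_tau.+1 => y 0 ord0 : R))); last first.
  by apply/funext => y; rewrite !fctE /= (mulrC (y 0 ord0)).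
apply: is_diff_eq; apply/funext => h; rewrite !fctE !mxE /GRing.scale /=.
rewrite (_ : (0 : _ -> R) h = 0) //.
by field.
Qed.

(** If |z| >= 1, the equation z^n (z - 1) = - r gives |z - 1| <= r.  Adding
    r z^n to both sides gives z^n (z - (1 - r)) = r (z^n - 1); the right-hand
    side is r (z - 1) (1 + z + ... + z^(n-1)), of modulus at most
    r * r * n |z|^n, so z is within r^2 n of 1 - r.  But z has modulus at least 1
    and so is at distance at least r from 1 - r, whence 1 <= r n. *)
Lemma char_root_norm_lt1 (C : numFieldType) (r z : C) (n : nat) :
  0 < r -> r * n.+1%:R < 1 -> z ^+ n.+1 = z ^+ n - r -> `|z| < 1.
Proof.
move=> r0 rn zE.
rewrite real_ltNge ?real1 ?normr_real //; apply/negP => z1.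
have zn0 : 0 < `|z| ^+ n by rewrite exprn_gt0 // (lt_le_trans ltr01).
have zn1 : 1 <= `|z| ^+ n by exact: exprn_ege1.
have zr : z ^+ n * (z - 1) = - r by rewrite mulrBr -exprSr zE; ring.
have z1r : `|z - 1| <= r.
  have : `|z| ^+ n * `|z - 1| = r by rewrite -normrX -normrM zr normrN gtr0_norm.
  by move=> <-; rewrite ler_peMl.
have key : z ^+ n * (z - (1 - r)) = r * ((z - 1) * \sum_(i < n) z ^+ i).
  by rewrite -subrX1 opprB addrCA addrC mulrDr zr; ring.
have sum_le : `|\sum_(i < n) z ^+ i| <= n%:R * `|z| ^+ n.
  apply: le_trans (ler_norm_sum _ _ _) _.
  rewrite -[n in n%:R]card_ord mulr_natl -sumr_const.
  by apply: ler_sum => i _; rewrite normrX ler_weXn2l // ltnW.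
have up : `|z - (1 - r)| <= r * (r * n%:R).
  rewrite -(ler_pM2l zn0) -normrX -normrM key !normrM (gtr0_norm r0) normrX.
  rewrite [leRHS](_ : _ = r * (r * (n%:R * `|z| ^+ n))); last by ring.
  by rewrite ler_pM2l // ler_pM.
have r1 : r <= 1.
  apply/ltW/(le_lt_trans _ rn); rewrite ler_peMr ?(ltW r0) //.
  by rewrite ler1n.
have low : r <= `|z - (1 - r)|.
  apply: le_trans (lerB_dist _ _); rewrite (ger0_norm (x := 1 - r)) ?subr_ge0 //.
  by rewrite opprB addrCA lerDl subr_ge0.
have := le_trans low up; rewrite ler_pMr // => rn1.
by have := lt_le_trans rn rn1; rewrite ltr_pM2l // ltr_nat ltnNge leqnSn.
Qed.

(** The Jacobian acts on row vectors as the linearized shift, so an eigenvector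
    is the geometric sequence v_j = z^j v_0 and v_0 is nonzero; the last
    coordinate of the eigenvector equation is the characteristic equation. *)
Lemma eigenvalue_jacobian_logistic (R : realType) (r K : R) (tau : nat) (z : R[i]) :
  K != 0 ->
  eigenvalue (map_mx (real_complex R)
    (jacobian (logistic_map r K (tau := tau)) (const_mx K))) z ->
  z ^+ tau.+1 = z ^+ tau - real_complex R r.
Proof.
move=> K0 /eigenvalueP [v vz v0].
have [_ dF] := is_diff_logistic r tau K0.
have JE i j : jacobian (logistic_map r K (tau := tau)) (const_mx K) i j =
    if (j < tau)%N then ((inord j.+1 == i))%:R
    else (ord_max == i)%:R - r * (ord0 == i)%:R.
  by rewrite /jacobian !mxE dF !mxE.
have vE j : z * v 0 j = if (j < tau)%N then v 0 (inord j.+1)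
    else v 0 ord_max - real_complex R r * v 0 ord0.
  move/rowP/(_ j): vz; rewrite !mxE => <-.
  (* Each column of the Jacobian is a combination of indicator vectors. *)
  have pick k : \sum_i v 0 i * real_complex R (k == i)%:R = v 0 k.
    rewrite (bigD1 k) //= eqxx rmorph1 mulr1 big1 ?addr0 // => i /negPf ik.
    by rewrite eq_sym ik rmorph0 mulr0.
  under eq_bigr do rewrite mxE JE.
  case: ifP => _; first exact: pick.
  rewrite -!pick mulr_sumr -sumrB; apply: eq_bigr => i _.
  by rewrite rmorphB rmorphM /= mulrBr mulrCA.
have vX j : v 0 j = z ^+ j * v 0 ord0.
  case: j => m; elim: m => [|m IH] mt.
    by rewrite expr0 mul1r; congr (v _ _); apply: val_inj.
  have := vE (Ordinal (ltnW mt)); rewrite IH /= ifT // exprS -mulrA => ->.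
  by congr (v _ _); apply: val_inj; rewrite /= inordK.
have w0 : v 0 ord0 != 0.
  apply: contra_neq v0 => w0; apply/rowP => j.
  by rewrite vX w0 mulr0 mxE.
apply: (mulIf w0); have := vE ord_max.
by rewrite ltnn vX mulrA -exprS mulrBl.
Qed.

Theorem mainTheorem2 (R : realType) :
  (forall (K r : R) (tau : nat), 0 < K ->
    let F := logistic_map r K (tau := tau) in
    let X1 : 'rV[R]_tau.+1 := const_mx 0 in
    let X2 : 'rV[R]_tau.+1 := const_mx K in
    [/\ fixed_point F X1, fixed_point F X2, X1 <> X2 &
        r <> 0 -> forall X, fixed_point F X -> X = X1 \/ X = X2]) /\
  (exists f : nat -> R,
    [/\ decreasing_seq f,
        forall tau : nat, 0 < f tau &
        forall (K r : R) (tau : nat), 0 < K -> 0 < r < f tau ->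
          stable_fixed_point (logistic_map r K (tau := tau)) (const_mx K)]).
Proof.
have fixK (K r : R) tau : 0 < K ->
    fixed_point (logistic_map r K (tau := tau)) (const_mx K).
  move=> K0; apply: fixed_point_logistic_const.
  by rewrite divff ?gt_eqF // subrr mulr0.
split=> [K r tau K0|].
  split.
  - by apply: fixed_point_logistic_const; rewrite mul0r.
  - exact: fixK.
  - move=> /rowP /(_ ord0); rewrite !mxE => K0'.
    by rewrite -K0' ltxx in K0.
  - by move=> /eqP r0 X; apply: fixed_point_logistic => //; exact: lt0r_neq0.
exists (fun n => n.+1%:R^-1); split.
- by move=> n m; rewrite lef_pV2 ?posrE ?ltr0Sn // ler_nat.
- by move=> n; rewrite invr_gt0 ltr0Sn.
move=> K r tau K0 /andP[r0 rf]; split; first exact: fixK.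
move=> z /eigenvalue_jacobian_logistic zE.
apply: (char_root_norm_lt1 (r := real_complex R r) (n := tau)).
- by rewrite -[0](rmorph0 (real_complex R)) ltcR.
- rewrite -(rmorph_nat (real_complex R)) -rmorphM -[ltRHS](rmorph1 (real_complex R)).
  by rewrite ltcR -ltr_pdivlMr ?ltr0Sn // mul1r.
- exact: zE (lt0r_neq0 K0).
Qed.
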